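(* Suppose that $\mu$ and $\eta$ are probability measures on $\mathbb{R}$. Let $\mu=\mu_a+\mu_s$ and $\eta=\eta_a+\eta_s$ be the Lebesgue decompositions of $\mu$ and $\eta$ into their absolutely continuous and singular parts, respectively (with respect to Lebesgue measure). If there exists $\sigma>0$ such that $\hat\mu(t)=\hat\eta(t)$ for all $t\in U_\sigma$, then $\mu_s=\eta_s$.
   Context: Probability measures are Borel probability measures on $\mathbb{R}$, and $\hat\mu(t)=\int_{\mathbb{R}}e^{-itx}\,d\mu(x)$, $t\in\mathbb{R}$. For $\sigma>0$, $U_\sigma=\{x\in\mathbb{R}:|x|>\sigma\}$. *)

(* Defs.v *)
From HB Require Import structures.
From mathcomp Require Import all_boot all_order all_algebra complex.
From mathcomp Require Import all_classical all_reals all_analysis.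

Set Implicit Arguments.
Unset Strict Implicit.
Unset Printing Implicit Defensive.

Import Order.TTheory GRing.Theory Num.Theory.
Import numFieldNormedType.Exports.

Local Open Scope classical_set_scope.
Local Open Scope ring_scope.
Local Open Scope complex_scope.

Definition cexp (R : realType) (z : R[i]) : R[i] :=
  (expR (complex.Re z))%:C * (cos (complex.Im z) +i* sin (complex.Im z)).

(* As for [Rintegral], the value is meaningful only when the real and imaginary
   parts of [f] are integrable. *)
Definition cintegral (R : realType) (d : measure_display)
    (T : measurableType d) (mu : {measure set T -> \bar R}) (f : T -> R[i]) :
    R[i] :=
  (\int[mu]_x complex.Re (f x)) +i* (\int[mu]_x complex.Im (f x)).

Definition fourier_transform (R : realType)
    (mu : {measure set (measurableTypeR R) -> \bar R}) (t : R) : R[i] :=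
  cintegral mu (fun x : R => cexp (- ('i * t%:C * x%:C))).

Definition U (R : realType) (sigma : R) : set R := [set x | sigma < `|x|].

Definition mutually_singular (R : realType) (d : measure_display)
    (T : measurableType d) (m1 m2 : set T -> \bar R) : Prop :=
  exists N : set T, [/\ measurable N, m1 (~` N) = 0%E & m2 N = 0%E].

(* A measure is a function on all sets whose values are constrained only on
   measurable ones, so equality of measures is stated on measurable sets. *)
Definition eq_measure_on_measurable (R : realType) (d : measure_display)
    (T : measurableType d) (m1 m2 : set T -> \bar R) : Prop :=
  forall A : set T, measurable A -> m1 A = m2 A.

Definition lebesgue_decomposition (R : realType)
    (mu mu_a mu_s : {measure set (measurableTypeR R) -> \bar R}) : Prop :=
  [/\ eq_measure_on_measurable mu (measure_add mu_a mu_s),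
      mu_a `<< (@lebesgue_measure R) &
      mutually_singular mu_s (@lebesgue_measure R)].

(* Main.v *)
Require Import Defs.
From mathcomp Require Import all_boot all_order all_algebra complex.
From mathcomp Require Import all_classical all_reals all_analysis.
From HB Require Import structures.
From mathcomp Require Import measurable_realfun ring lra.

Import Order.TTheory GRing.Theory Num.Theory.
Import numFieldNormedType.Exports.

Local Open Scope classical_set_scope.
Local Open Scope ring_scope.

(** The difference of [mu] and [eta] has a Fourier transform that is bounded
and supported in [[-sigma, sigma]], so formally it has a bounded density by
Fourier inversion.  The proof makes this precise without an inversion theorem,
by showing [mu A <= eta A + C * lebesgue_measure A] for all Borel sets [A] and
[C = 2 * sigma / pi] ([le_measure_of_le_itvoc]); by symmetry the same holds
with [mu] and [eta] exchanged.  On a Lebesgue-null Borel set the last term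
vanishes, so there [mu] and [eta] agree; since the singular parts are the
traces of [mu] and [eta] on such a set, they are equal ([singular_part_eq]).

The inequality is obtained by smoothing with the Poisson kernel
[e / (e ^+ 2 + y ^+ 2)], which is the Laplace transform in [e] of
[cos (t * y)].  By Tonelli its integral against a probability measure is an
integral over [t >= 0] of the Fourier transform damped by [expR (- (e * t))].
For [mu] and [eta] the integrands coincide for [t > sigma], and for
[t <= sigma] they differ by at most [2]; hence the two smoothed measures differ
by at most [2 * sigma] at every point, uniformly in [e]
([le_integral_poisson]).  Integrating over an interval turns the kernel into a
difference of arctangents, and letting [e] tend to [0] gives the inequality
for half-open intervals ([le_measure_itvoc]).

All the integrands can be kept nonnegative by using [1 + cos (t * y)] in place
of [cos (t * y)]: the additional term is the same for all probability
measures. *)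

(** * The Poisson kernel *)

Section poisson_kernel.
Context {R : realType}.
Notation leb := (@lebesgue_measure R).

(** Up to the factor [pi], this is the Poisson kernel of the upper half-plane
at height [e]. *)
Definition poisson (e y : R) : R := e / (e ^+ 2 + y ^+ 2).

Let poisson_den_neq0 (e y : R) : 0 < e -> e ^+ 2 + y ^+ 2 != 0.
Proof. by move=> e0; rewrite lt0r_neq0// ltr_wpDr ?sqr_ge0// exprn_gt0. Qed.

Lemma poisson_ge0 (e y : R) : 0 < e -> 0 <= poisson e y.
Proof. by move=> e0; rewrite divr_ge0 ?addr_ge0 ?sqr_ge0// ltW. Qed.

Lemma continuous_poisson (e : R) : 0 < e -> continuous (poisson e).
Proof.
move=> e0 y; apply: cvgM; first exact: cvg_cst.
apply: cvgV; first exact: poisson_den_neq0.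
by apply: cvgD; [exact: cvg_cst|rewrite expr2; apply: cvgM; exact: cvg_id].
Qed.

Lemma measurable_poisson {d} {T : measurableType d} (e : R) (f : T -> R) :
  0 < e -> measurable_fun setT f -> measurable_fun setT (poisson e \o f).
Proof.
move=> e0; apply: measurableT_comp.
exact: (continuous_measurable_fun (continuous_poisson e e0)).
Qed.

(** The Laplace transform of [1 + cos (t * y)].  The summand [1] makes the
integrand nonnegative; its own contribution [e^-1] does not depend on [y]. *)
Lemma integral_expR_1Dcos (e y : R) : 0 < e ->
  (\int[leb]_(t in `[0%R, +oo[) (expR (- (e * t)) * (1 + cos (t * y)))%:E =
   (e^-1 + poisson e y)%:E)%E.
Proof.
move=> e0; have D0 := poisson_den_neq0 e y e0.
pose F t : R := expR (- (e * t)) *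
  ((y * sin (t * y) - e * cos (t * y)) / (e ^+ 2 + y ^+ 2) - e^-1).
have dF (t : R) :
    is_derive t (1 : R) F (expR (- (e * t)) * (1 + cos (t * y))).
  apply: is_derive_eq; rewrite /GRing.scale/=.
  by move: D0 (lt0r_neq0 e0) => D0 en0; field; rewrite en0 D0.
have cf : continuous (fun t : R => expR (- (e * t)) * (1 + cos (t * y))).
  move=> t; apply: differentiable_continuous; apply/derivable1_diffP.
  exact: ex_derive.
have cF : continuous F.
  move=> t; apply: differentiable_continuous; apply/derivable1_diffP.
  exact: ex_derive.
rewrite (@ge0_continuous_FTC2y _ _ F 0 0)//.
- rewrite /F !mulr0 oppr0 expR0 mul0r sin0 cos0 sub0e -EFinN /poisson.
  by congr (_%:E); field; rewrite D0 lt0r_neq0.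
- by apply: continuous_subspaceT.
- have e0y : expR (- (e * t)) @[t --> +oo] --> (0:R).
    apply: (@cvg_comp _ _ _ (fun t => e * t) (fun z => expR (- z)) _
      (pinfty_nbhs R)).
      exact: gt0_cvgMry.
    exact: cvgr_expR.
  (* the cofactor of the exponential is bounded by K *)
  pose K := (`|y| + e) / (e ^+ 2 + y ^+ 2) + e^-1.
  apply: norm_cvg0.
  apply: (@squeeze_cvgr _ _ _ _ (cst 0) (fun t => expR (- (e * t)) * K)).
  + apply: nearW => t; rewrite normr_ge0/= normrM ger0_norm ?expR_ge0//.
    rewrite ler_pM2l ?expR_gt0// (le_trans (ler_normB _ _))// lerD//; last first.
      by rewrite ger0_norm// invr_ge0 ltW.
    rewrite normrM [X in _ * X]ger0_norm ?invr_ge0 ?addr_ge0 ?sqr_ge0//.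
    rewrite ler_wpM2r ?invr_ge0 ?addr_ge0 ?sqr_ge0//.
    rewrite (le_trans (ler_normB _ _))// !normrM (ger0_norm (ltW e0)) lerD//.
      by rewrite ler_piMr// ler_norml sin_geN1 sin_le1.
    by rewrite ler_piMr ?(ltW e0)// ler_norml cos_geN1 cos_le1.
  + exact: cvg_cst.
  + by rewrite -[X in _ --> X](mul0r K); apply: cvgM => //; exact: cvg_cst.
- by apply: cvg_at_right_filter; exact: cF.
- by move=> t _; rewrite derive1E; exact: derive_val.
Qed.

Lemma integral_poisson (e x c d : R) : 0 < e -> c < d ->
  (\int[leb]_(a in `[c, d]) (poisson e (x - a))%:E =
   (atan ((d - x) / e) - atan ((c - x) / e))%:E)%E.
Proof.
move=> e0 cd.
pose F a : R := atan ((a - x) / e).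
have dF (a : R) : is_derive a (1 : R) F (poisson e (x - a)).
  have D1 : 1 + ((a - x) / e) ^+ 2 != 0 by rewrite lt0r_neq0// ltr_wpDr ?sqr_ge0.
  apply: is_derive_eq; rewrite /GRing.scale/= /poisson.
  move: (poisson_den_neq0 e (x - a) e0) D1 (lt0r_neq0 e0) => D0 D1 en0.
  by field; rewrite D0 en0.
have cF : continuous F.
  move=> t; apply: differentiable_continuous; apply/derivable1_diffP.
  exact: ex_derive.
rewrite (@continuous_FTC2 _ _ F)//.
- apply: continuous_subspaceT => a.
  apply: (@continuous_comp _ _ _ (fun a => x - a) (poisson e)).
    by apply: cvgB; [exact: cvg_cst|exact: cvg_id].
  exact: continuous_poisson.
- split.
  + by move=> a _; exact: ex_derive.
  + by apply: cvg_at_right_filter; exact: cF.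
  + by apply: cvg_at_left_filter; exact: cF.
- by move=> t _; rewrite derive1E; exact: derive_val.
Qed.

End poisson_kernel.

(** * Tonelli's theorem over a measurable subset *)

Lemma fubini_tonelli_on {R : realType} {d1 d2} {T1 : measurableType d1}
    {T2 : measurableType d2} (m1 : {sigma_finite_measure set T1 -> \bar R})
    (m2 : {sigma_finite_measure set T2 -> \bar R}) (D : set T2)
    (f : T1 -> T2 -> R) :
  measurable D -> measurable_fun setT (fun z : T1 * T2 => f z.1 z.2) ->
  (forall x t, 0 <= f x t) ->
  (\int[m1]_x \int[m2]_(t in D) (f x t)%:E =
   \int[m2]_(t in D) \int[m1]_x (f x t)%:E)%E.
Proof.
move=> mD mf f0.
pose g (z : T1 * T2) := (f z.1 z.2 * \1_D z.2)%:E.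
have mg : measurable_fun [set: T1 * T2] (g : _ -> \bar R).
  apply/measurable_EFinP; apply: measurable_funM => //.
  by apply: measurableT_comp => //; exact: measurable_indic.
have gD x : (\int[m2]_(t in D) (f x t)%:E = \int[m2]_t g (x, t))%E.
  rewrite integral_mkcond; apply: eq_integral => t _.
  by rewrite /g/= indicE patchE; case: ifPn => _; rewrite (mulr1, mulr0).
under eq_integral do rewrite gD.
rewrite (@fubini_tonelli _ _ _ _ _ m1 m2 g mg); last first.
  by move=> z; rewrite lee_fin mulr_ge0.
rewrite [RHS]integral_mkcond; apply: eq_integral => t _.
rewrite patchE /g/= indicE; case: ifPn => _.
  by under eq_integral do rewrite mulr1.
by under eq_integral do rewrite mulr0; rewrite integral0.
Qed.

(** * The Fourier transform in real terms *)

Section fourier.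
Context {R : realType}.
Implicit Types mu : probability (measurableTypeR R) R.

Lemma integrable_continuous_norm_le1 mu (f : R -> R) : continuous f ->
  (forall x, `|f x| <= 1) -> mu.-integrable setT (EFin \o f).
Proof.
move=> cf f1; apply: measurable_bounded_integrable => //.
- by rewrite (le_lt_trans (probability_le1 _ _)) ?ltry.
- exact: continuous_measurable_fun.
- exists 1; split; first exact: real1.
  by move=> M M1 x _; rewrite /= (le_trans (f1 x))// ltW.
Qed.

Lemma integrable_cosM mu (s : R) :
  mu.-integrable setT (EFin \o (fun x : R => cos (s * x))).
Proof.
apply: integrable_continuous_norm_le1.
  move=> x; apply: (@continuous_comp _ _ _ (fun x => s * x) cos).
    exact: mulrl_continuous.
  exact: continuous_cos.
by move=> x; rewrite ler_norml cos_geN1 cos_le1.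
Qed.

Lemma integrable_sinM mu (s : R) :
  mu.-integrable setT (EFin \o (fun x : R => sin (s * x))).
Proof.
apply: integrable_continuous_norm_le1.
  move=> x; apply: (@continuous_comp _ _ _ (fun x => s * x) sin).
    exact: mulrl_continuous.
  exact: continuous_sin.
by move=> x; rewrite ler_norml sin_geN1 sin_le1.
Qed.

Lemma fourier_transformE mu (t : R) :
  fourier_transform mu t =
  ((\int[mu]_x cos (t * x)) +i* (- \int[mu]_x sin (t * x)))%C.
Proof.
rewrite /fourier_transform /cintegral; congr (_ +i* _)%C.
  apply: eq_Rintegral => x _; rewrite /cexp /=.
  rewrite !(mul0r, mulr0, mul1r, subr0, add0r, oppr0, subrr).
  by rewrite expR0 mul1r cosN.
rewrite -mulN1r -RintegralZl//; last exact: integrable_sinM.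
apply: eq_Rintegral => x _; rewrite /cexp /=.
rewrite !(mul0r, mulr0, mul1r, subr0, add0r, oppr0, subrr, addr0).
by rewrite expR0 mul1r sinN mulN1r.
Qed.

(** The point of this formula is that the left-hand side depends on [mu] only
through the value at [t] of its Fourier transform. *)
Lemma integral_1Dcos mu (t a : R) :
  (\int[mu]_x (1 + cos (t * (x - a)))%:E =
   (1 + (complex.Re (fourier_transform mu t) * cos (t * a) -
         complex.Im (fourier_transform mu t) * sin (t * a)))%:E)%E.
Proof.
have ic := integrable_cosM mu t; have isn := integrable_sinM mu t.
have i1 : mu.-integrable setT (EFin \o (fun _ : R => 1 : R)).
  apply: integrable_continuous_norm_le1 => [|x]; first exact: cst_continuous.
  by rewrite normr1.
pose f x : R := 1 + (cos (t * x) * cos (t * a) + sin (t * x) * sin (t * a)).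
have icc : mu.-integrable setT
    (EFin \o (fun x : R => cos (t * x) * cos (t * a))).
  exact: (integrableZr measurableT (cos (t * a)) ic).
have iss : mu.-integrable setT
    (EFin \o (fun x : R => sin (t * x) * sin (t * a))).
  exact: (integrableZr measurableT (sin (t * a)) isn).
have ics : mu.-integrable setT (EFin \o
    (fun x : R => cos (t * x) * cos (t * a) + sin (t * x) * sin (t * a))).
  exact: (integrableD measurableT icc iss).
have iF : mu.-integrable setT (EFin \o f).
  exact: (integrableD measurableT i1 ics).
transitivity (\int[mu]_x (f x)%:E)%E.
  by apply: eq_integral => x _; rewrite /f mulrBr cosB.
rewrite -[LHS]fineK; last exact: integrable_fin_num.
rewrite fourier_transformE; congr (_%:E); rewrite -[LHS]/(\int[mu]_x (f x)) /f.
rewrite RintegralD// RintegralD// !RintegralZr// Rintegral_cst//.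
by rewrite [X in fine X]probability_setT mulr1/= mulNr opprK.
Qed.

End fourier.

(** * Poisson integrals of measures whose Fourier transforms agree far out *)

Section poisson_integral.
Context {R : realType}.
Notation leb := (@lebesgue_measure R).
Implicit Types mu : probability (measurableTypeR R) R.

Lemma measurable_1Dcos (t a : R) : measurable_fun setT
  (fun x : measurableTypeR R => 1 + cos (t * (x - a))).
Proof.
apply: measurable_funD => //; apply: measurableT_comp.
  exact: (continuous_measurable_fun (@continuous_cos R)).
by apply: measurable_funM => //; exact: measurable_funB.
Qed.

Lemma measurable_expR_1Dcos (e a : R) : measurable_fun setT
  (fun z : measurableTypeR R * measurableTypeR R =>
    expR (- (e * z.2)) * (1 + cos (z.2 * (z.1 - a)))).
Proof.
apply: measurable_funM.
  by do 2 apply: measurableT_comp => //; exact: measurable_funM.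
apply: measurable_funD => //; apply: measurableT_comp.
  exact: (continuous_measurable_fun (@continuous_cos R)).
by apply: measurable_funM => //; exact: measurable_funB.
Qed.

Lemma cos1D_ge0 (y : R) : 0 <= 1 + cos y.
Proof. by rewrite -lerBlDl sub0r cos_geN1. Qed.

Local Open Scope ereal_scope.

Lemma integral_poisson_fourier mu (e a : R) : (0 < e)%R ->
  (e^-1)%:E + \int[mu]_x (poisson e (x - a))%:E =
  \int[leb]_(t in `[0%R, +oo[)
    \int[mu]_x (expR (- (e * t)) * (1 + cos (t * (x - a))))%:E.
Proof.
move=> e0.
rewrite -(fubini_tonelli_on mu leb _
    (fun x t => expR (- (e * t)) * (1 + cos (t * (x - a))))%R)//; last first.
  exact: measurable_expR_1Dcos.
under [RHS]eq_integral do rewrite integral_expR_1Dcos// EFinD.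
rewrite ge0_integralD//.
- by rewrite integral_cst//= [X in _ * X]probability_setT mule1.
- by move=> x _; rewrite lee_fin invr_ge0 ltW.
- by move=> x _; rewrite lee_fin poisson_ge0.
- apply/measurable_EFinP; apply: measurable_poisson => //.
  exact: measurable_funB.
Qed.

(** In the representation of the Poisson integral as an integral over
[t >= 0], frequencies [t > sigma] contribute the same for both measures, and
each [t] in [[0, sigma]] contributes at most [2]. *)
Lemma le_integral_poisson (mu eta : probability (measurableTypeR R) R)
    (sigma : R) : (0 < sigma)%R ->
  (forall t, U sigma t -> fourier_transform mu t = fourier_transform eta t) ->
  forall e a : R, (0 < e)%R ->
  \int[mu]_x (poisson e (x - a))%:E <=
  \int[eta]_x (poisson e (x - a))%:E + (2 * sigma)%:E.
Proof.
move=> sigma0 mueta e a e0.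
rewrite -(@leeD2lE _ (e^-1)%:E)// [leRHS]addeA !integral_poisson_fourier//.
pose f (x t : R) : R := (expR (- (e * t)) * (1 + cos (t * (x - a))))%R.
pose G (m : probability (measurableTypeR R) R) (t : measurableTypeR R) :=
  \int[m]_x (f x t)%:E.
have f0 x t : (0 <= f x t)%R by rewrite mulr_ge0 ?expR_ge0 ?cos1D_ge0.
have G0 m t : 0 <= G m t by apply: integral_ge0 => x _; rewrite lee_fin.
have mf : measurable_fun [set: measurableTypeR R * measurableTypeR R]
    (fun z => (f z.1 z.2)%:E).
  by apply/measurable_EFinP; exact: measurable_expR_1Dcos.
have mG m : measurable_fun setT (G m).
  apply: (measurable_fun_fubini_tonelli_G (m1 := m) _ mf) => z.
  by rewrite lee_fin.
have mft t : measurable_fun setT (fun x : measurableTypeR R => (f x t)%:E).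
  by apply: measurable_fun_pair1 mf.
have G2 m t : (0 <= t)%R -> G m t <= 2%:E.
  move=> t0; apply: (@le_trans _ _ (\int[m]_x (cst 2%:E x))).
    apply: ge0_le_integral => //.
    + by move=> x _; rewrite lee_fin.
    + move=> x _; rewrite lee_fin -[leRHS]mul1r ler_pM ?expR_ge0 ?cos1D_ge0//.
        by rewrite -expR0 ler_expR oppr_le0 mulr_ge0// ltW.
      by rewrite -[leRHS]/(1 + 1)%R lerD2l cos_le1.
  by rewrite integral_cst//= [X in _ * X]probability_setT mule1.
have GE t : (sigma < t)%R -> G mu t = G eta t.
  move=> st.
  have GZ m : G m t =
      (expR (- (e * t)))%:E * \int[m]_x (1 + cos (t * (x - a)))%:E.
    rewrite /G; under eq_integral do rewrite /f EFinM.
    rewrite ge0_integralZl// ?lee_fin ?expR_ge0//.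
    by apply/measurable_EFinP; exact: measurable_1Dcos.
  rewrite !GZ !integral_1Dcos mueta//.
  by rewrite /U/= (lt_le_trans st)// ler_norm.
have itvE : `[0%R, +oo[%classic = `[0%R, sigma] `|` `]sigma, +oo[ :> set R.
  by rewrite -itv_bndbnd_setU ?bnd_simp//; exact: ltW.
have dis : [disjoint `[0%R, sigma] & `]sigma, +oo[%classic].
  apply/disj_setPS => y [/=]; rewrite !in_itv/= andbT => /andP[_ ys].
  by rewrite ltNge ys.
change (\int[leb]_(t in `[0%R, +oo[) G mu t <=
  \int[leb]_(t in `[0%R, +oo[) G eta t + (2 * sigma)%:E).
rewrite [X in X <= _](_ : _ = \int[leb]_(t in `[0%R, sigma]) G mu t +
   \int[leb]_(t in `]sigma, +oo[) G mu t); last first.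
  by rewrite itvE ge0_integral_setU//; exact: measurable_funTS.
rewrite addeC leeD//.
  rewrite (@eq_integral _ _ _ _ _ (G eta)); last first.
    by move=> t; rewrite inE/= in_itv/= andbT => /GE.
  apply: ge0_subset_integral => //; first exact: measurable_funTS.
  by rewrite itvE; exact: subsetUr.
apply: (@le_trans _ _ (\int[leb]_(t in `[0%R, sigma]) (cst 2%:E t))).
  apply: ge0_le_integral => //; first exact: measurable_funTS.
  by move=> t; rewrite /= in_itv/= => /andP[t0 _]; exact: G2.
rewrite integral_cst// [X in _ * X]lebesgue_measure_itv/= lte_fin sigma0.
by rewrite -EFinB subr0 -EFinM.
Qed.

End poisson_integral.

(** * Comparison of the two measures on half-open intervals *)

Section interval_comparison.
Context {R : realType}.
Notation leb := (@lebesgue_measure R).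

(** The shift [n.+1%:R^-1] of the end point is infinitely larger than the
scale [n.+1%:R ^- 2] of the smoothing: so at [x = b] the limit is the one from
[x < b], rather than the mean value [0], and half-open intervals appear in the
limit of the smoothed measures. *)
Lemma cvg_atan_step (x b : R) :
  atan ((b + n.+1%:R^-1 - x) / (n.+1%:R ^- 2)) @[n --> \oo] -->
  (if x <= b then pi / 2 else - (pi / 2) : R).
Proof.
have Sn : (n.+1%:R : R) @[n --> \oo] --> +oo.
  by rewrite (cvg_shiftS (fun n => n%:R : R)); exact: cvgr_idn.
have -> : (fun n => atan ((b + n.+1%:R^-1 - x) / (n.+1%:R ^- 2))) =
    (fun n => atan (n.+1%:R * (n.+1%:R * (b - x) + 1))) :> (nat -> R).
  apply/funext => n; congr atan.
  have : (n.+1%:R : R) != 0 by rewrite pnatr_eq0.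
  by move: (n.+1%:R : R) => m m0; field.
case: ifPn => [xb|].
  apply: (@cvg_comp _ _ _ (fun n => n.+1%:R * (n.+1%:R * (b - x) + 1) : R) atan
    _ (pinfty_nbhs R)); last exact: cvgy_atan.
  apply: ger_cvgy (Sn); apply: nearW => n.
  by rewrite ler_peMr// lerDr mulr_ge0// subr_ge0.
rewrite -ltNge => bx.
rewrite (_ : (fun n => _) =
    (fun n => - atan (n.+1%:R * (n.+1%:R * (x - b) - 1)))); last first.
  by apply/funext => n; rewrite -atanN; congr atan; ring.
apply: cvgN.
apply: (@cvg_comp _ _ _ (fun n => n.+1%:R * (n.+1%:R * (x - b) - 1) : R) atan
  _ (pinfty_nbhs R)); last exact: cvgy_atan.
apply: ger_cvgy (Sn); near=> n.
rewrite ler_peMr// lerBrDr -ler_pdivrMr ?subr_gt0//.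
near: n.
by move/cvgryPge : Sn; apply.
Unshelve. all: by end_near. Qed.

Lemma continuous_atan_affine (b e : R) :
  continuous (fun x : R => atan ((b - x) / e)).
Proof.
move=> x; apply: (@continuous_comp _ _ _ (fun x => (b - x) / e) atan).
  by apply: cvgM; [apply: cvgB; [exact: cvg_cst|exact: cvg_id]|exact: cvg_cst].
exact: continuous_atan.
Qed.

Local Open Scope ereal_scope.

Lemma cvg_integral_atan (mu : probability (measurableTypeR R) R) (c d : R) :
  (c < d)%R ->
  \int[mu]_x (atan ((d + n.+1%:R^-1 - x) / (n.+1%:R ^- 2)) -
              atan ((c + n.+1%:R^-1 - x) / (n.+1%:R ^- 2)))%:E @[n --> \oo] -->
  pi%:E * mu `]c, d]%classic.
Proof.
move=> cd.
pose f n x : R := (atan ((d + n.+1%:R^-1 - x) / (n.+1%:R ^- 2)) -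
              atan ((c + n.+1%:R^-1 - x) / (n.+1%:R ^- 2)))%R.
pose g (x : R) : R := (pi * \1_(`]c, d]%classic : set R) x)%R.
have mf n : measurable_fun setT (f n).
  apply: measurable_funB; apply: continuous_measurable_fun;
    exact: continuous_atan_affine.
have fg x : f n x @[n --> \oo] --> g x.
  suff <- : ((if x <= d then pi / 2 else - (pi / 2)) -
      (if x <= c then pi / 2 else - (pi / 2)))%R = g x.
    by apply: cvgB; exact: cvg_atan_step.
  rewrite /g indicE mem_setE in_itv/=.
  case: (leP x c) => xc; case: (leP x d) => xd /=;
    rewrite ?mulr1 ?mulr0 ?subrr//.
  - by move: (lt_trans cd xd); rewrite ltNge xc.
  - by rewrite opprK -splitr.
have mfE n : measurable_fun setT (fun x : measurableTypeR R => (f n x)%:E).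
  by apply/measurable_EFinP; exact: mf.
have mg : measurable_fun setT (fun x : measurableTypeR R => (g x)%:E).
  by apply/measurable_EFinP; apply: measurable_funM.
have fgE : {ae mu, forall x, setT x -> (f n x)%:E @[n --> \oo] --> (g x)%:E}.
  by apply/aeW => x _; apply: cvg_EFin; [exact: nearW|exact: fg].
have ipi : mu.-integrable setT (cst pi%:E).
  apply/integrableP; split => //.
  by rewrite integral_cst//= [X in _ * X]probability_setT mule1 ltry.
have fpi : {ae mu, forall x n, setT x -> `|(f n x)%:E| <= pi%:E}.
  have atan_pihalf (y : R) : (`|atan y| <= pi / 2)%R.
    by rewrite ler_norml (ltW (atan_ltpi2 _)) (ltW (atan_gtNpi2 _)).
  apply/aeW => x n _; rewrite lee_fin /f (le_trans (ler_normB _ _))//.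
  by rewrite [leRHS]splitr lerD.
have [_ _] := dominated_convergence measurableT mfE mg fgE ipi fpi.
have -> // : \int[mu]_x (g x)%:E = pi%:E * mu `]c, d]%classic.
rewrite /g; under eq_integral do rewrite EFinM.
rewrite ge0_integralZl//= ?lee_fin ?pi_ge0//.
  by rewrite integral_indic//= setIT.
by apply/measurable_EFinP; exact: measurable_indic.
Qed.

Section compare.
Variables (mu eta : probability (measurableTypeR R) R) (sigma : R).
Hypothesis sigma0 : (0 < sigma)%R.
Hypothesis le_poisson : forall e a : R, (0 < e)%R ->
  \int[mu]_x (poisson e (x - a))%:E <=
  \int[eta]_x (poisson e (x - a))%:E + (2 * sigma)%:E.

(** Integrate the hypothesis over [a] in [[c, d]] and exchange the
integrals. *)
Lemma le_integral_atan (e c d : R) : (0 < e)%R -> (c < d)%R ->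
  \int[mu]_x (atan ((d - x) / e) - atan ((c - x) / e))%:E <=
  \int[eta]_x (atan ((d - x) / e) - atan ((c - x) / e))%:E +
    (2 * sigma * (d - c))%:E.
Proof.
move=> e0 cd.
pose f (x a : R) : R := poisson e (x - a).
pose G (m : probability (measurableTypeR R) R) (t : measurableTypeR R) :=
  \int[m]_x (f x t)%:E.
have f0 x a : (0 <= f x a)%R by exact: poisson_ge0.
have mf : measurable_fun [set: measurableTypeR R * measurableTypeR R]
    (fun z => f z.1 z.2).
  by apply: measurable_poisson => //; exact: measurable_funB.
have mG m : measurable_fun setT (G m).
  apply: (measurable_fun_fubini_tonelli_G (m1 := m)
    (fun z => (f z.1 z.2)%:E)) => [|z]; first exact/measurable_EFinP.
  by rewrite lee_fin.
have G0 m t : 0 <= G m t by apply: integral_ge0 => x _; rewrite lee_fin.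
have E (m : probability (measurableTypeR R) R) :
    \int[m]_x (atan ((d - x) / e) - atan ((c - x) / e))%:E =
    \int[leb]_(a in `[c, d]) G m a.
  under eq_integral do rewrite -integral_poisson//.
  by rewrite (fubini_tonelli_on m leb _ f).
rewrite !E.
apply: (@le_trans _ _ (\int[leb]_(a in `[c, d]) (G eta a + (2 * sigma)%:E))).
  apply: ge0_le_integral => //.
  - exact: measurable_funTS.
  - by apply: emeasurable_funD => //; exact: measurable_funTS.
  - by move=> a _; exact: le_poisson.
rewrite ge0_integralD//; last 2 first.
  - exact: measurable_funTS.
  - by move=> a _; rewrite lee_fin mulr_ge0// ltW.
rewrite integral_cst// [X in _ * X]lebesgue_measure_itv/= lte_fin cd.
by rewrite -EFinB -EFinM.
Qed.

Lemma le_measure_itvoc (c d : R) : (c < d)%R ->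
  mu `]c, d]%classic <= eta `]c, d]%classic + (2 * sigma / pi * (d - c))%:E.
Proof.
move=> cd.
rewrite -(@lee_pmul2l _ pi%:E)// ?lte_fin ?pi_gt0// muleDr//; last first.
  by rewrite fin_num_adde_defl.
have -> : pi%:E * (2 * sigma / pi * (d - c))%:E = (2 * sigma * (d - c))%:E.
  have := lt0r_neq0 (pi_gt0 R); move: (pi : R) => p p0.
  by rewrite -EFinM; congr (_%:E); field.
have etaD := cvgeD (fin_num_adde_defl _ _) (cvg_integral_atan eta c d cd)
  (cvg_cst (2 * sigma * (d - c))%:E).
apply: (lee_cvg_to (cvg_integral_atan mu c d cd) (etaD _ _ _)) => //.
apply: nearW => n.
have := @le_integral_atan (n.+1%:R ^- 2) (c + n.+1%:R^-1) (d + n.+1%:R^-1).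
rewrite invr_gt0 exprn_gt0// ltrD2r => /(_ isT cd) /=.
by rewrite (_ : d + n.+1%:R^-1 - (c + n.+1%:R^-1) = d - c)%R//; ring.
Qed.

End compare.
End interval_comparison.

(** * From half-open intervals to Borel sets *)

Section distribution_function.
Context {R : realType} (P : probability (measurableTypeR R) R).

Let idTR : measurableTypeR R -> R := idfun.
#[local] HB.instance Definition _ :=
  @isMeasurableFun.Build _ _ _ _ idTR (@measurable_id _ _ setT).

Definition dist_fun (r : R) : R := fine (P `]-oo, r]%classic).

Lemma dist_fun_right_continuous : right_continuous dist_fun.
Proof.
move=> a; apply: fine_cvg; rewrite fineK ?fin_num_measure//.
have := @cdf_right_continuous _ _ _ P (idTR : {RV P >-> R}) a.
by rewrite /cdf /distribution /pushforward; exact.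
Qed.

Lemma measure_itvoc_dist_fun (a b : R) : a <= b ->
  P `]a, b]%classic = (dist_fun b - dist_fun a)%:E.
Proof.
move=> ab; rewrite EFinB !fineK ?fin_num_measure//.
have -> : `]a, b]%classic = `]-oo, b] `\` `]-oo, a].
  by rewrite -[RHS]setCK setCD setCitvl setUC -[LHS]setCK setCitv.
rewrite measureD ?setIidr//; first exact: subset_itvl.
by rewrite -ge0_fin_numE// fin_num_measure.
Qed.

End distribution_function.

Section domination.
Context {R : realType} (mu eta : probability (measurableTypeR R) R) (C : R).
Hypothesis C0 : 0 <= C.
Hypothesis muetaC : forall a b : R, a < b ->
  (mu `]a, b]%classic <= eta `]a, b]%classic + (C * (b - a))%:E)%E.

Let F (x : R) : R := dist_fun eta x + C * x - dist_fun mu x.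

Let F_nd : nondecreasing F.
Proof.
move=> a b; rewrite le_eqVlt => /predU1P[->//|ab].
have := muetaC _ _ ab.
rewrite !measure_itvoc_dist_fun ?(ltW ab)// -EFinD lee_fin /F.
by lra.
Qed.

Let F_rc : right_continuous F.
Proof.
move=> a; apply: cvgB; last exact: dist_fun_right_continuous.
apply: cvgD; first exact: dist_fun_right_continuous.
by apply: cvgM; [exact: cvg_cst|exact: cvg_at_right_filter].
Qed.

#[local] HB.instance Definition _ := isCumulative.Build R _ R F F_nd F_rc.

(** An inequality between measures on a generating semiring does not pass to
the sigma-algebra by a pi-lambda argument, but an equality does.  The
hypothesis says that [F] is nondecreasing, so the defect in the inequality is
itself a measure, the Lebesgue-Stieltjes measure of [F]; adding it to [mu]
turns the inequality into an equality. *)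
Lemma le_measure_of_le_itvoc (A : set (measurableTypeR R)) : measurable A ->
  (mu A <= eta A + C%:E * lebesgue_measure A)%E.
Proof.
move=> mA.
pose G := [set X : set (measurableTypeR R) | ocitv X].
pose kmu := measure_add (lebesgue_stieltjes_measure F) mu.
pose el := measure_add eta (mscale (NngNum C0) (@lebesgue_measure R)).
have wl (f : cumulative R R) a b : a <= b ->
    lebesgue_stieltjes_measure f `]a, b]%classic = (f b - f a)%:E.
  move=> ab; rewrite /lebesgue_stieltjes_measure /measure_extension/=.
  rewrite measurable_mu_extE/=; last exact: is_ocitv.
  by rewrite wlength_itv_bnd.
have E : kmu A = el A.
  apply: (measure_unique G (fun k => `]- k%:R, k%:R]%classic)) => //.
  - exact: ocitvI.
  - by move=> k; exact: is_ocitv.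
  - exact: bigcup_itvT.
  - move=> X [[a b]]/= _ <-.
    have [ab|ba] := leP a b; last first.
      by rewrite set_itv_ge ?measure0// bnd_simp -leNgt ltW.
    change (kmu `]a, b]%classic = el `]a, b]%classic).
    rewrite /kmu /el !measure_addE/= /mscale/= wl// /lebesgue_measure wl//.
    rewrite !measure_itvoc_dist_fun// -EFinM -!EFinD /F/=; congr (_%:E).
    change (F b - F a + (dist_fun mu b - dist_fun mu a) =
      dist_fun eta b - dist_fun eta a + C * (b - a)).
    by rewrite /F; ring.
  - move=> k; pose I : set R := `]- k%:R, k%:R]%classic.
    change (kmu I < +oo)%E; rewrite /kmu measure_addE/= wl.
      apply: lte_add_pinfty; first exact: ltry.
      rewrite (le_lt_trans (probability_le1 _ _)) ?ltry//.
      exact: measurable_itv.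
    by apply: (@le_trans _ _ 0); rewrite ?oppr_le0.
have : (mu A <= kmu A)%E by rewrite /kmu measure_addE leeDr.
by rewrite E /el measure_addE.
Qed.

End domination.

(** * Equality of the singular parts *)

(** Let [N] and [M] be null sets carrying the two singular parts.  On subsets
of their union the absolutely continuous parts vanish, as do the terms
[C%:E * lebesgue_measure A], so the two inequalities become an equality of
singular parts there; off the union both singular parts vanish. *)
Lemma singular_part_eq {R : realType} (mu eta mu_a mu_s eta_a eta_s :
    {measure set (measurableTypeR R) -> \bar R}) (C : R) :
  lebesgue_decomposition mu mu_a mu_s ->
  lebesgue_decomposition eta eta_a eta_s ->
  (forall A, measurable A -> (mu A <= eta A + C%:E * lebesgue_measure A)%E) ->
  (forall A, measurable A -> (eta A <= mu A + C%:E * lebesgue_measure A)%E) ->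
  eq_measure_on_measurable mu_s eta_s.
Proof.
move=> [muE mu_ac [N [mN muN lN]]] [etaE eta_ac [M [mM etaM lM]]] mueta etamu.
move=> A mA.
pose B := A `&` (N `|` M).
have mB : measurable B by apply: measurableI => //; exact: measurableU.
have NM0 : lebesgue_measure (N `|` M) = 0%E by rewrite measureU0.
have lB : lebesgue_measure B = 0%E.
  apply: (@subset_measure0 _ _ _ _ _ (N `|` M)) => //.
  - exact: measurableU.
  - exact: subIsetr.
have sB (m : {measure set (measurableTypeR R) -> \bar R}) P : measurable P ->
    P `<=` N `|` M -> m (~` P) = 0%E -> m A = m B.
  move=> mP PNM mP0.
  rewrite (@measureDI _ _ _ m A (N `|` M))//; last exact: measurableU.
  rewrite (@subset_measure0 _ _ _ m _ (~` P)) ?add0e//.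
  - by apply: measurableD => //; exact: measurableU.
  - exact: measurableC.
  - by move=> x [_ xNM] Px; apply: xNM; exact: PNM.
have aB (m : {measure set (measurableTypeR R) -> \bar R}) :
    m `<< (@lebesgue_measure R) -> m B = 0%E.
  by move=> /null_content_dominatesP; exact.
have muB : mu B = mu_s A.
  by rewrite muE// measure_addE (aB mu_a)// add0e -(sB mu_s N).
have etaB : eta B = eta_s A.
  by rewrite etaE// measure_addE (aB eta_a)// add0e -(sB eta_s M).
apply/eqP; rewrite eq_le -muB -etaB; apply/andP; split.
  by have := mueta B mB; rewrite [lebesgue_measure B]lB mule0 adde0.
by have := etamu B mB; rewrite [lebesgue_measure B]lB mule0 adde0.
Qed.

Theorem proposition1p2 (R : realType)
    (mu eta : probability (measurableTypeR R) R)
    (mu_a mu_s eta_a eta_s : {measure set (measurableTypeR R) -> \bar R})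
    (hmu : lebesgue_decomposition mu mu_a mu_s)
    (heta : lebesgue_decomposition eta eta_a eta_s)
    (hfourier : exists sigma : R, 0 < sigma /\
       forall t : R, U sigma t -> fourier_transform mu t = fourier_transform eta t) :
  eq_measure_on_measurable mu_s eta_s.
Proof.
have [sigma [sigma0 mueta]] := hfourier.
have C0 : 0 <= 2 * sigma / pi.
  by rewrite divr_ge0 ?pi_ge0// mulr_ge0// ltW.
apply: (singular_part_eq mu eta mu_a mu_s eta_a eta_s (2 * sigma / pi)) => //.
- apply: le_measure_of_le_itvoc => //.
  by apply: le_measure_itvoc => //; exact: le_integral_poisson.
- apply: le_measure_of_le_itvoc => //.
  apply: le_measure_itvoc => //; apply: le_integral_poisson => // t Ut.
  by rewrite mueta.
Qed.
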